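(* For every finite tree-like metric space $(Y,d)$ one has $\|\eta\|_{\text{Æ}(Y)}=\|\eta\|_C$ for all $\eta\in M_0(Y)$, where $\|\cdot\|_C$ is the canonical C-norm associated with the distance $d$ of $Y$, i.e. $$\|\eta\|_C=\sum_{\delta_S\in\Sigma_d}\alpha_d(S)\Big|\sum_{z\in S}\eta(z)\Big| .$$
   Context: A finite metric space $(Y,d)$ is tree-like if it embeds isometrically into (the vertex set of) a finite weighted tree, i.e. a connected graph without cycles with positive edge weights and distance given by the sum of the weights along the path joining two vertices. For $S\subseteq Y$, the cut semi-metric is $\delta_S(x,y)=1$ if exactly one of $x,y$ belongs to $S$, and $0$ otherwise (so $\delta_S=\delta_{Y\setminus S}$). For a partition of $Y$ into two non-empty sets $S,\bar S=Y\setminus S$, the isolation index is $$\alpha_d(S)=\tfrac12\min_{x,y\in S;\ u,v\in\bar S}\Big(\max\{d(x,y)+d(u,v),\,d(x,u)+d(y,v),\,d(x,v)+d(y,u)\}-d(x,y)-d(u,v)\Big),$$ where $x=y$ and $u=v$ are allowed. $\delta_S$ is a $d$-split if $\alpha_d(S)>0$, and $\Sigma_d$ is the set of all $d$-splits $\delta_S$ (each split $\{S,\bar S\}$ counted once). Every finite distance has the canonical Bandelt–Dress decomposition $d=d_0+\sum_{\delta_S\in\Sigma_d}\alpha_d(S)\delta_S$; $d$ is totally decomposable if $d_0=0$. Tree-like metrics are totally decomposable. For a totally decomposable $d$ the canonical C-norm is the norm $\|\cdot\|_C$ displayed in the claim. $M_0(Y)$ is the vector space of functions $\eta:Y\to\mathbb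 R$ with $\sum_{y\in Y}\eta(y)=0$. The Arens–Eells norm is $$\|\eta\|_{\text{Æ}(Y)}=\inf\Big\{\sum_{x,y\in Y}|a(x,y)|\,d(x,y)\ :\ a\in\mathbb R^{Y\times Y},\ \eta=\sum_{x,y\in Y}a(x,y)(\delta_x-\delta_y)\Big\},$$ where, with a single point as index, $\delta_x$ denotes the indicator function of $\{x\}$. *)

(* Defs.v *)
From HB Require Import structures.
From mathcomp Require Import boolp classical_sets reals.
From mathcomp Require Import all_boot all_order all_algebra.

Set Implicit Arguments.
Unset Strict Implicit.
Unset Printing Implicit Defensive.

Import Order.TTheory GRing.Theory Num.Theory.
Local Open Scope ring_scope.

Definition is_metric (R : realType) (Y : Type) (d : Y -> Y -> R) : Prop :=
  [/\ forall x y, 0 <= d x y,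
      forall x y, d x y = 0 <-> x = y,
      forall x y, d x y = d y x
    & forall x y z, d x z <= d x y + d y z].

Definition is_tree (V : finType) (e : rel V) : Prop :=
  [/\ symmetric e, irreflexive e, forall x y, connect e x y
    & forall c : seq V, (2 < size c)%N -> ~~ ucycleb e c].

(* Only the values of [w] on the edges of [e] matter. *)
Definition is_edge_weight (R : realType) (V : finType) (e : rel V)
    (w : V -> V -> R) : Prop :=
  forall u v, e u v -> 0 < w u v /\ w u v = w v u.

(* Sum of the weights of the consecutive edges of the walk x :: p. *)
Definition walk_weight (R : realType) (V : Type) (w : V -> V -> R)
    (x : V) (p : seq V) : R :=
  \sum_(l <- pairmap w x p) l.

(* In a tree the simple path from u to v exists and is unique, so [r] is the
   distance between u and v. *)
Definition is_tree_distance (R : realType) (V : finType) (e : rel V)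
    (w : V -> V -> R) (u v : V) (r : R) : Prop :=
  exists p : seq V,
    [/\ path e u p, uniq (u :: p), last u p = v & r = walk_weight w u p].

Definition tree_like (R : realType) (Y : finType) (d : Y -> Y -> R) : Prop :=
  is_metric d /\
  exists (V : finType) (e : rel V) (w : V -> V -> R) (f : Y -> V),
    [/\ is_tree e, is_edge_weight e w
      & forall x y, is_tree_distance e w (f x) (f y) (d x y)].

(* The {0,1}-valued cut semi-metric is encoded as a boolean function. *)
Definition cut (Y : finType) (S : {set Y}) : {ffun Y * Y -> bool} :=
  [ffun p => (p.1 \in S) (+) (p.2 \in S)].

(* The infimum is over a finite set, which is nonempty when S and its
   complement are: it is then a minimum, see [isolation_index_min]. *)
Definition isolation_index (R : realType) (Y : finType) (d : Y -> Y -> R)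
    (S : {set Y}) : R :=
  2^-1 * inf [set r : R | exists x y u v : Y,
    [/\ x \in S, y \in S, u \in ~: S, v \in ~: S
      & r = Num.max (d x y + d u v)
              (Num.max (d x u + d y v) (d x v + d y u))
            - d x y - d u v]]%classic.

Definition splits (R : realType) (Y : finType) (d : Y -> Y -> R) :
    {set {ffun Y * Y -> bool}} :=
  [set cut S | S : {set Y}
     & [&& S != set0, ~: S != set0 & 0 < isolation_index d S]].

(* One of the two sides S of the split delta_S; the choice is irrelevant by
   [cut_inj], [isolation_indexC] and [norm_sumC]. *)
Definition side (Y : finType) (delta : {ffun Y * Y -> bool}) : {set Y} :=
  odflt set0 [pick S | cut S == delta].

Definition C_norm (R : realType) (Y : finType) (d : Y -> Y -> R)
    (eta : Y -> R) : R :=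
  \sum_(delta in splits d)
    isolation_index d (side delta) * `|\sum_(z in side delta) eta z|.

Definition M0 (R : realType) (Y : finType) (eta : Y -> R) : Prop :=
  \sum_(y : Y) eta y = 0.

Definition AE_norm (R : realType) (Y : finType) (d : Y -> Y -> R)
    (eta : Y -> R) : R :=
  inf [set r : R | exists a : Y -> Y -> R,
    (forall z, eta z =
       \sum_(x : Y) \sum_(y : Y) a x y * ((z == x)%:R - (z == y)%:R)) /\
    r = \sum_(x : Y) \sum_(y : Y) `|a x y| * d x y]%classic.

Lemma cut_side (Y : finType) (S : {set Y}) : cut (side (cut S)) = cut S.
Proof.
by rewrite /side; case: pickP => [T /eqP //|/(_ S)]; rewrite eqxx.
Qed.

Lemma cut_inj (Y : finType) (S T : {set Y}) :
  cut S = cut T -> S = T \/ S = ~: T.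
Proof.
move=> /ffunP eST.
have [->|/eqP] := eqVneq S T; first by left.
move=> /setP neST; right; apply/setP => y; rewrite inE.
have [//|/negPn/eqP ey] := boolP ((y \in S) != (y \in T)).
  by case: (y \in S); case: (y \in T).
case: neST => z; have := eST (z, y); rewrite !ffunE /= ey.
by move/addIb.
Qed.

Lemma isolation_indexC (R : realType) (Y : finType) (d : Y -> Y -> R)
    (S : {set Y}) :
  (forall x y, d x y = d y x) -> isolation_index d (~: S) = isolation_index d S.
Proof.
move=> dC; rewrite /isolation_index; congr (_ * inf _).
rewrite predeqE => r; split=> -[x [y [u [v [xS yS uS vS ->]]]]];
  exists u, v, x, y; rewrite ?setCK in uS vS *; split=> //;
  rewrite (addrC (d u v)) (dC u x) (dC v y) (dC u y) (dC v x);
  by rewrite (addrC (d y u)) addrAC.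
Qed.

Lemma norm_sumC (R : realType) (Y : finType) (eta : Y -> R) (S : {set Y}) :
  M0 eta -> `|\sum_(z in ~: S) eta z| = `|\sum_(z in S) eta z|.
Proof.
rewrite /M0 (bigID (mem S)) /= => /eqP; rewrite addr_eq0 => /eqP ->.
by rewrite normrN; under eq_bigl do rewrite inE.
Qed.

Lemma isolation_index_min (R : realType) (Y : finType) (d : Y -> Y -> R)
    (S : {set Y}) (g : Y -> Y -> Y -> Y -> R :=
      fun x y u v => Num.max (d x y + d u v)
        (Num.max (d x u + d y v) (d x v + d y u)) - d x y - d u v) :
  S != set0 -> ~: S != set0 ->
  exists x y u v : Y,
    [/\ x \in S, y \in S, u \in ~: S & v \in ~: S] /\
    [/\ isolation_index d S = 2^-1 * g x y u v
      & forall x' y' u' v', x' \in S -> y' \in S -> u' \in ~: S ->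
          v' \in ~: S -> g x y u v <= g x' y' u' v'].
Proof.
move=> /set0Pn[x0 x0S] /set0Pn[u0 u0S].
pose P (q : Y * Y * (Y * Y)) :=
  [&& q.1.1 \in S, q.1.2 \in S, q.2.1 \in ~: S & q.2.2 \in ~: S].
pose F (q : Y * Y * (Y * Y)) := g q.1.1 q.1.2 q.2.1 q.2.2.
have P0 : P (x0, x0, (u0, u0)) by rewrite /P /= x0S u0S.
case: (arg_minP F P0) => -[[x y] [u v]] /and4P[/= xS yS uS vS] qmin.
have gmin x' y' u' v' : x' \in S -> y' \in S -> u' \in ~: S -> v' \in ~: S ->
    g x y u v <= g x' y' u' v'.
  by move=> *; apply: (qmin (x', y', (u', v'))); apply/and4P; split.
exists x, y, u, v; split=> //; split=> //; congr (_ * _).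
apply/eqP; rewrite eq_le; apply/andP; split.
  apply: ge_inf; last by exists x, y, u, v.
  by exists (g x y u v) => _ [x' [y' [u' [v' [? ? ? ? ->]]]]]; apply: gmin.
apply: lb_le_inf; first by exists (g x y u v), x, y, u, v.
by move=> _ [x' [y' [u' [v' [? ? ? ? ->]]]]]; apply: gmin.
Qed.

(* Main.v *)
(** Removing an edge of the tree splits Y into two sides, any two such splits
    are compatible (one of the four intersections of their sides is empty), and
    d is the weighted sum of the corresponding cuts.  Compatibility makes the
    isolation index of a split equal to the total weight of the edges inducing
    it, so ||eta||_C is the sum over the edges of the weight times the absolute
    mass of a side.  Every representation of eta costs at least this sum, since
    the mass of each side has to cross the edge.  Conversely, a representation
    of this cost is built greedily: by laminarity, from any point x of positive
    mass some point y of negative mass can be reached so that every side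
    containing x and not y has positive mass; moving a small amount from x to y
    then lowers all these masses at the exact rate paid by d(x, y).  Moving as
    much as possible annihilates the mass of a side, and zero masses stay zero.
    Singletons are added to the sides, with weight 0, so that exhausting a
    point is one of these annihilations. *)

Require Import Defs.
From mathcomp Require Import boolp classical_sets reals.
From mathcomp Require Import all_boot all_order all_algebra.
From mathcomp Require Import lra.

Set Implicit Arguments.
Unset Strict Implicit.
Unset Printing Implicit Defensive.

Import Order.TTheory GRing.Theory Num.Theory.
Local Open Scope ring_scope.

(** * Trees: edge deletion and the two sides of an edge *)

Lemma connect_invariant (T : finType) (r : rel T) (P : pred T) (x y : T) :
  (forall a b, P a -> r a b -> P b) -> P x -> connect r x y -> P y.
Proof.
move=> Pr Px /connectP[p rp ->]; elim: p x Px rp => //= a p IHp x Px.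
by case/andP=> rxa; apply: IHp; apply: Pr rxa.
Qed.

Definition del_edge (V : eqType) (e : rel V) (u v : V) : rel V :=
  fun a b => [&& e a b, (a, b) != (u, v) & (a, b) != (v, u)].

Definition edge_side (V : finType) (e : rel V) (u v : V) : {set V} :=
  [set z | connect (del_edge e u v) u z].

Lemma del_edgeC (V : eqType) (e : rel V) (u v : V) :
  del_edge e u v =2 del_edge e v u.
Proof. by move=> a b; congr (_ && _); apply: andbC. Qed.

Lemma del_edge_sym (V : eqType) (e : rel V) (u v : V) :
  symmetric e -> symmetric (del_edge e u v).
Proof.
move=> eC a b; rewrite /del_edge eC !xpair_eqE.
rewrite (andbC (b == u)) (andbC (b == v)).
by congr (_ && _); apply: andbC.
Qed.

Lemma path_del_edge (V : finType) (e : rel V) (u v s : V) (x : V) (p : seq V) :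
  s \in [:: u; v] -> path e x p -> s \notin x :: p ->
  connect (del_edge e u v) x (last x p).
Proof.
move=> suv; elim: p x => [|y p IHp] x /=; first by rewrite connect0.
case/andP=> exy ep; rewrite !inE !negb_or => /and3P[sx sy sp].
apply: connect_trans (IHp y ep _); last by rewrite !inE negb_or sy sp.
apply: connect1; rewrite /del_edge exy !xpair_eqE /= !negb_and.
move: suv; rewrite !inE => /orP[]/eqP E; move: sx sy; rewrite E.
  by rewrite (eq_sym u x) (eq_sym u y) => -> ->; rewrite orbT.
by rewrite (eq_sym v x) (eq_sym v y) => -> ->; rewrite orbT.
Qed.

Section Tree.
Variables (V : finType) (e : rel V).
Hypothesis tree_e : is_tree e.

Lemma mem_edge_side (u v : V) : u \in edge_side e u v.
Proof. by rewrite inE connect0. Qed.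

Lemma edge_side_step (u v a b : V) :
  del_edge e u v a b -> (a \in edge_side e u v) = (b \in edge_side e u v).
Proof.
case: tree_e => eC _ _ _ eab; rewrite !inE.
exact: same_connect1r (sym_connect_sym (del_edge_sym u v eC)) _ _ eab _.
Qed.

(** Otherwise a simple path from [u] to [v] avoiding the edge would close up with it into a
    cycle. *)
Lemma edge_sideN (u v : V) : e u v -> v \notin edge_side e u v.
Proof.
case: tree_e => eC eI _ acyc euv; rewrite inE; apply/negP => /connectP[p ep].
case: (shortenP ep) => q eq uq _ lq.
have eeq : path e u q by apply: sub_path eq => a b /and3P[].
case: q eq uq lq eeq => [|a [|b q]] /=.
- by move=> _ _ euv'; rewrite euv' eI in euv.
- by move=> /andP[eua _] _ va; move: eua; rewrite va /del_edge eqxx andbF.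
move=> _ uq lq eeq.
have := acyc [:: u, a, b & q] isT.
rewrite /ucycleb /= uq andbT rcons_path /= -lq (eC v) euv andbT.
by case/and3P: eeq => -> -> ->.
Qed.

(** Connectedness makes the two sides cover [V]; a common vertex would connect [u] to [v] without
    the edge. *)
Lemma edge_sideC (u v : V) : e u v -> edge_side e v u = ~: edge_side e u v.
Proof.
case: tree_e => eC eI conn _ euv; apply/setP => z; rewrite in_setC.
have cover : (z \in edge_side e u v) || (z \in edge_side e v u).
  pose P z := (z \in edge_side e u v) || (z \in edge_side e v u).
  apply: (@connect_invariant _ e P u z) => //; last 1 first.
    by rewrite /P mem_edge_side.
  move=> a b; rewrite /P => Pa eab.
  have [dab|] := boolP (del_edge e u v a b).
    rewrite -(edge_side_step dab) -(@edge_side_step v u a b) //.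
    by rewrite del_edgeC.
  rewrite /del_edge eab /= negb_and !negbK => /orP[] /eqP[_ ->];
    by rewrite mem_edge_side ?orbT.
have [zu|zu] := boolP (z \in edge_side e u v); last first.
  by move: cover; rewrite (negPf zu).
apply/negP; rewrite inE => zv; have /negP[] := edge_sideN euv.
move: zu; rewrite !inE => zu; apply: connect_trans zu _.
rewrite (sym_connect_sym (del_edge_sym u v eC)).
by rewrite (eq_connect (del_edgeC e u v)).
Qed.

(** Induction on the path: its first step is the edge, its reverse, or keeps the side. In the first
    two cases the rest avoids the endpoint [x], so it stays on one side. *)
Lemma mem_zip_path (x : V) (p : seq V) (u v : V) :
  e u v -> path e x p -> uniq (x :: p) ->
  ((u, v) \in zip (x :: p) p) =
  (x \in edge_side e u v) && (last x p \notin edge_side e u v).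
Proof.
case: tree_e => eC _ _ _ euv.
elim: p x => [|y p IHp] x; first by rewrite /= in_nil andbN.
rewrite [path _ _ _]/= [uniq _]/= => /andP[exy ep] /andP[xp up].
rewrite [zip _ _]/= inE IHp //= {IHp}.
have con s t (x_st : x \in [:: s; t]) := path_del_edge x_st ep xp.
have [[-> ->]|nxy] /= := eqVneq (u, v) (x, y).
  rewrite mem_edge_side; apply/esym; rewrite -in_setC -edge_sideC // inE.
  by apply: con; rewrite !inE eqxx orbT.
have [[uE vE]|nyx] := eqVneq (u, v) (y, x).
  rewrite uE vE in euv *.
  rewrite (negPf (edge_sideN euv)) mem_edge_side /= inE con //.
  by rewrite !inE eqxx orbT.
rewrite (@edge_side_step u v x y) // /del_edge exy (eq_sym _ (u, v)) nxy /=.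
by move: nyx; rewrite !xpair_eqE negb_and negb_and orbC eq_sym (eq_sym u).
Qed.

(* One of the four intersections of [A] or its complement with [B] or its
   complement is empty; [b] and [c] say which. *)
Definition compatible (T : finType) (A B : {set T}) : Prop :=
  exists b c : bool, forall z, ~~ (((z \in A) == b) && ((z \in B) == c)).

(** The side of the first edge that avoids [s] is connected without using the second edge, so it
    lies entirely on one side of the latter. *)
Lemma edge_side_compatible (u v s t : V) :
  e u v -> e s t -> compatible (edge_side e u v) (edge_side e s t).
Proof.
move=> euv est.
have key a b : e a b -> s \notin edge_side e a b ->
  forall z, z \in edge_side e a b ->
    (z \in edge_side e s t) = (a \in edge_side e s t).
  move=> eab sab z; rewrite inE => abz.
  pose P z := (z \in edge_side e a b) &&
              ((z \in edge_side e s t) == (a \in edge_side e s t)).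
  suff /andP[_ /eqP] : P z by [].
  apply: connect_invariant abz; last by rewrite /P mem_edge_side eqxx.
  move=> c c' /andP[ca /eqP cE] dcc.
  have c'a : c' \in edge_side e a b by rewrite -(edge_side_step dcc).
  rewrite /P c'a -cE eq_sym; apply/eqP/edge_side_step.
  case/and3P: dcc => ecc _ _; rewrite /del_edge ecc !xpair_eqE !negb_and.
  have -> : c != s by apply: contraNneq sab => <-.
  by have -> : c' != s by [apply: contraNneq sab => <-]; rewrite orbT.
have [suv|suv] := boolP (s \in edge_side e u v).
  have evu : e v u by case: tree_e => eC _ _ _; rewrite eC.
  have svu : s \notin edge_side e v u by rewrite (edge_sideC euv) inE negbK.
  exists false, (v \notin edge_side e s t) => z.
  apply/negP => /andP[/eqP zN]; rewrite (key v u evu svu).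
    by case: (v \in _).
  by rewrite (edge_sideC euv) in_setC zN.
exists true, (u \notin edge_side e s t) => z.
by apply/negP => /andP[/eqP zN]; rewrite (key u v euv suv) //; case: (u \in _).
Qed.

(** The path enters the right-hand side only through its endpoints; this is what turns distances
    into sums of cuts. *)
Lemma walk_weightE (R : realType) (w : V -> V -> R) (x : V) (p : seq V) :
  path e x p -> uniq (x :: p) ->
  walk_weight w x p = \sum_(q : V * V | e q.1 q.2) w q.1 q.2 *
    ((x \in edge_side e q.1 q.2) && (last x p \notin edge_side e q.1 q.2))%:R.
Proof.
move=> ep up.
have pairmapE (s : seq V) y :
    pairmap w y s = [seq w q.1 q.2 | q <- zip (y :: s) s].
  by elim: s y => //= a s IHs y; rewrite IHs.
have zipe (s : seq V) y :
    path e y s -> all (fun q => e q.1 q.2) (zip (y :: s) s).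
  by elim: s y => //= a s IHs y /andP[-> /IHs].
rewrite /walk_weight pairmapE big_map big_uniq; last exact: zip_uniql.
rewrite [RHS](eq_bigr (fun q : V * V =>
    if q \in zip (x :: p) p then w q.1 q.2 else 0)); last first.
  move=> [a b] /= eab; rewrite (mem_zip_path eab) //.
  by case: ifP; rewrite ?mulr1 ?mulr0.
rewrite -big_mkcondr; apply: eq_bigl => q /=; apply/idP/andP => [qp|[]//].
by split=> //; apply: (allP (zipe _ _ ep)).
Qed.

End Tree.

(** * From a tree to a compatible family of weighted cuts *)

Definition separates (T : finType) (A : {set T}) (x y : T) : bool :=
  (x \in A) (+) (y \in A).

Lemma cut_eqP (Y : finType) (A B : {set Y}) :
  reflect (forall x y, separates A x y = separates B x y) (cut A == cut B).
Proof.
apply: (iffP eqP) => [/ffunP AB x y|AB].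
  by have := AB (x, y); rewrite !ffunE.
by apply/ffunP => -[x y]; rewrite !ffunE /=; apply: AB.
Qed.

Lemma compatible_set1 (T : finType) (z : T) (A : {set T}) :
  compatible [set z] A.
Proof.
exists true, (z \notin A) => t; rewrite inE.
by have [->|] := eqVneq t z => //=; case: (z \in A).
Qed.

Lemma compatibleC (T : finType) (A B : {set T}) :
  compatible A B -> compatible B A.
Proof. by case=> b [c bc]; exists c, b => z; rewrite andbC. Qed.

(** All that is kept of the tree. Sides are indexed because several edges may induce the same cut of
    [Y], or a trivial one. *)
Record cut_decomposition (R : realType) (Y I : finType) (d : Y -> Y -> R)
    (S : I -> {set Y}) (w : I -> R) : Prop := CutDecomposition {
  weight_ge0 : forall i, 0 <= w i;
  side_compatible : forall i j, compatible (S i) (S j);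
  singleton_side : forall z, exists i, S i = [set z];
  cut_sum : forall x y, d x y = \sum_i w i * (separates (S i) x y)%:R }.

Lemma tree_like_cut_decomposition (R : realType) (Y : finType)
    (d : Y -> Y -> R) :
  tree_like d ->
  exists (I : finType) (S : I -> {set Y}) (w : I -> R), cut_decomposition d S w.
Proof.
case=> -[_ _ dC _] [V [e [w [f [tree_e we dtree]]]]].
pose S (i : V * V + Y) : {set Y} := match i with
  | inl q => if e q.1 q.2 then f @^-1: edge_side e q.1 q.2 else set0
  | inr z => [set z] end.
(* Both orientations of an edge are indices, so each gets half the weight. *)
pose c (i : V * V + Y) : R := match i with
  | inl q => if e q.1 q.2 then 2^-1 * w q.1 q.2 else 0
  | inr z => 0 end.
exists (V * V + Y)%type, S, c; split.
- case=> [q|z] //=; case: ifP => // /we[w0 _].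
  by rewrite mulr_ge0 ?invr_ge0 // ltW.
- have c0 (A : {set Y}) : compatible set0 A.
    by exists true, true => z; rewrite inE.
  case=> [p|z] [q|t] /=; try (do [exact: compatible_set1 |
    apply: compatibleC; exact: compatible_set1]).
  case: ifP => // ep; case: ifP => [eq|_]; last exact: compatibleC.
  case: (edge_side_compatible tree_e ep eq) => a [b ab].
  by exists a, b => z; rewrite !inE; have := ab (f z); rewrite !inE.
- by move=> z; exists (inr z).
move=> x y; rewrite big_sumType /= [X in _ + X]big1 ?addr0; last first.
  by move=> z _; rewrite mul0r.
pose D x y := \sum_(q : V * V | e q.1 q.2) w q.1 q.2 *
  ((f x \in edge_side e q.1 q.2) && (f y \notin edge_side e q.1 q.2))%:R.
have dD a b : d a b = D a b.
  case: (dtree a b) => p [ep up lp ->].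
  by rewrite (walk_weightE tree_e) // /D lp.
(* [D x y] sees only edges oriented from [x] towards [y]; averaging with [D y x] leaves a symmetric
   condition, separation. *)
have -> : d x y = 2^-1 * (D x y + D y x).
  by rewrite -!dD (dC y x); lra.
rewrite /D -big_split /= mulr_sumr big_mkcond /=; apply: eq_bigr => q _.
case: ifP => eq; last by rewrite mul0r.
rewrite -mulrA -mulrDr -natrD /separates !inE.
by congr (_ * (_ * _%:R)); case: (connect _ _ (f x)); case: (connect _ _ (f y)).
Qed.

(** * Laminarity of sides seen from a fixed point *)

Definition side_of (T : finType) (A : {set T}) (x : T) : {set T} :=
  [set z | ~~ separates A x z].

Lemma separatesC (T : finType) (A : {set T}) (x y : T) :
  separates A x y = separates A y x.
Proof. exact: addbC. Qed.

(** The empty intersection granted by compatibility is not the one containing [x]; each of the other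
    three gives one alternative. *)
Lemma side_ofC_laminar (T : finType) (A B : {set T}) (x : T) :
  compatible A B ->
  [\/ ~: side_of A x \subset ~: side_of B x,
      ~: side_of B x \subset ~: side_of A x
    | [disjoint ~: side_of A x & ~: side_of B x]].
Proof.
case=> b [c bc]; have := bc x.
have [bE|bE] := eqVneq b (x \in A); have [cE|cE] := eqVneq c (x \in B).
- by [].
- constructor 2; apply/subsetP => z; move: cE (bc z).
  rewrite !inE bE /separates.
  by case: c {bc}; do 4!case: (_ \in _).
- constructor 1; apply/subsetP => z; move: bE (bc z).
  rewrite !inE cE /separates.
  by case: b {bc}; do 4!case: (_ \in _).
constructor 3; rewrite disjoints_subset; apply/subsetP => z; move: bE cE (bc z).
rewrite !inE /separates.
by case: b {bc}; case: c; do 4!case: (_ \in _).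
Qed.

Lemma side_of_nested (T : finType) (A B : {set T}) (x u : T) :
  compatible A B -> u \notin side_of A x -> u \notin side_of B x ->
  side_of A x \subset side_of B x \/ side_of B x \subset side_of A x.
Proof.
move=> AB; rewrite -!(in_setC u) => uA uB.
case: (side_ofC_laminar x AB) => [|| /disjointFr/(_ uA)]; rewrite ?setCS.
- by right.
- by left.
by rewrite uB.
Qed.

(** A member of maximal cardinality contains or is disjoint from every other one; split it off and
    induct on the members disjoint from it. *)
Lemma sum_laminar_cover_ge0 (R : realDomainType) (T : finType) (eta : T -> R)
    (F : {set {set T}}) :
  {in F &, forall A B : {set T},
     [\/ A \subset B, B \subset A | [disjoint A & B]]} ->
  {in F, forall A : {set T}, 0 <= \sum_(z in A) eta z} ->
  0 <= \sum_(z in cover F) eta z.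
Proof.
have [n] := ubnP #|F|; elim: n F => // n IHn F ltFn lamF F0.
have [->|/set0Pn[A0 A0F]] := eqVneq F set0.
  by rewrite /cover big_set0 big_set0.
case: (arg_maxnP (fun A : {set T} => #|A|) A0F) => A AF Amax.
pose G := [set B in F :\ A | [disjoint A & B]].
have coverE : cover F = A :|: cover G.
  apply/setP => z; rewrite in_setU; apply/bigcupP/orP => [[B BF zB]|[zA|]].
  - have [->|BA] := eqVneq A B; first by left.
    have [dAB|ndAB] := boolP [disjoint A & B].
      by right; apply/bigcupP; exists B; rewrite // !inE BF eq_sym BA.
    left; case: (lamF A B AF BF) => [AB|/subsetP/(_ z zB)//|dAB]; last first.
      by rewrite dAB in ndAB.
    by have /eqP -> : A == B by rewrite eqEcard AB; apply: Amax.
  - by exists A.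
  by case/bigcupP => B; rewrite !inE => /andP[/andP[_ BF] _]; exists B.
have dAG : [disjoint A & cover G].
  by apply/bigcup_disjoint => B; rewrite !inE => /andP[].
rewrite coverE (eq_bigl [predU A & cover G]) ?bigU //= => [|z];
  last by rewrite !inE.
apply: addr_ge0; first exact: F0.
apply: IHn.
- rewrite -ltnS (leq_trans _ ltFn) // ltnS proper_card //.
  apply/properP; split; last by exists A; rewrite // !inE eqxx.
  by apply/subsetP => B; rewrite !inE => /andP[/andP[]].
- move=> B C; rewrite !inE => /andP[/andP[_ BF] _] /andP[/andP[_ CF] _].
  exact: lamF.
by move=> B; rewrite !inE => /andP[/andP[_ BF] _]; exact: F0.
Qed.

Lemma sum_eq_mem (R : pzSemiRingType) (T : finType) (A : {set T}) (t : T) :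
  \sum_(z in A) (z == t)%:R = (t \in A)%:R :> R.
Proof.
have [tA|tA] := boolP (t \in A).
  by rewrite (bigD1 t) //= eqxx big1 ?addr0 // => z /andP[_ /negPf ->].
by rewrite big1 // => z zA; case: eqVneq zA tA => // -> ->.
Qed.

(** * Isolation indices and the C-norm of a cut decomposition *)

Section CutDecomposition.
Variables (R : realType) (Y I : finType) (d : Y -> Y -> R).
Variables (S : I -> {set Y}) (w : I -> R).
Hypothesis dec : cut_decomposition d S w.

(* Two sides containing [x] but not [u] are nested, so those in which [T] is
   not contained have a largest element: [y] is picked in [T] outside of it. *)
Lemma separating_point (T : {set Y}) (x u : Y) : x \in T ->
  exists2 y, y \in T & forall i, u \notin side_of (S i) x ->
    y \in side_of (S i) x -> T \subset side_of (S i) x.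
Proof.
move=> xT; pose A i := side_of (S i) x.
have [i0 bad0|nobad] := pickP [pred i | (u \notin A i) && ~~ (T \subset A i)];
    last first.
  exists x => // i ui _; have /= := nobad i.
  by rewrite /A ui => /negbFE.
case: (arg_maxnP (fun i => #|A i|) bad0) => i /=
  /andP[ui /subsetPn[y yT yi]] imax.
exists y => // j uj yj; apply: contraNT yi => Tj.
have := imax j; rewrite /= uj => /(_ Tj) card_ji.
have [ij|/subsetP ji] := side_of_nested (side_compatible dec i j) ui uj.
  by have /eqP -> : A i == A j by rewrite eqEcard ij.
exact: ji.
Qed.

(** With [separating_point] applied on both sides of [T], such a cut has [T] within the side of [x]
    and its complement within the side of [u]. *)
Lemma isolating_quartet (T : {set Y}) : T != set0 -> ~: T != set0 ->
  exists x y u v, [/\ [/\ x \in T, y \in T, u \in ~: T & v \in ~: T]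
    & forall i, [&& ~~ separates (S i) x y, ~~ separates (S i) u v
                  & separates (S i) x u] -> cut (S i) == cut T].
Proof.
move=> /set0Pn[x xT] /set0Pn[u uT].
have [y yT xyP] := separating_point u xT.
have [v vT uvP] := separating_point x uT.
exists x, y, u, v; split=> // i /and3P[xy uv xu].
have /subsetP Tx : T \subset side_of (S i) x by apply: xyP; rewrite !inE ?negbK.
have /subsetP Tu : ~: T \subset side_of (S i) u.
  by apply: uvP; rewrite !inE ?negbK // separatesC.
have sideP z : z \in S i = (x \in S i) (+) (z \notin T).
  have [/Tx|] := boolP (z \in T).
    by rewrite inE /separates; do 2!case: (_ \in _).
  rewrite -in_setC => /Tu; move: xu; rewrite inE /separates.
  by do 3!case: (_ \in _).
apply/cut_eqP => a b; rewrite /separates (sideP a) (sideP b).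
by do 3!case: (_ \in _).
Qed.

Lemma isolation_index_le (T : {set Y}) : T != set0 -> ~: T != set0 ->
  isolation_index d T <= \sum_(i | cut (S i) == cut T) w i.
Proof.
move=> T0 CT0; have [x [y [u [v [[xT yT uT vT] iso]]]]] :=
  isolating_quartet T0 CT0.
have [x' [y' [u' [v' [_ [-> /(_ x y u v xT yT uT vT) le_g]]]]]] :=
  isolation_index_min d T0 CT0.
(* A cut contributes at most 2 to the excess of either alternative pairing over
   [d x y + d u v], and only if it separates [x, y] from [u, v]. *)
have key a b a' b' : (forall i, (separates (S i) a b + separates (S i) a' b' <=
      (cut (S i) == cut T) * 2 + separates (S i) u v + separates (S i) x y)%N)
    ->
    d a b + d a' b' <= 2 * (\sum_(i | cut (S i) == cut T) w i) + d u v + d x y.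
  move=> ab; rewrite big_mkcond /= mulr_sumr !(cut_sum dec) -!big_split /=.
  apply: ler_sum => i _; have := ab i; rewrite -(ler_nat R) !natrD natrM.
  move/(ler_wpM2l (weight_ge0 dec i)); case: ifP => _ /=; lra.
rewrite ler_pdivrMl // (le_trans le_g) //.
rewrite !lerBlDr !ge_max !key // => i; have := iso i; rewrite /separates;
  case: (x \in _); case: (y \in _); case: (u \in _); case: (v \in _);
  by do ?[move=> /(_ isT) -> | move=> _; case: (_ == _)].
Qed.

(** At a minimizing quartet, pairing [x] with [u] and [y] with [v] suffices. The cut of [T]
    contributes 2 to the excess; any other cut of the family is compatible with it, so it cannot
    separate both [x] from [y] and [u] from [v], and contributes at least 0. *)
Lemma isolation_index_ge (T : {set Y}) (j : I) : T != set0 -> ~: T != set0 ->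
  cut (S j) = cut T -> \sum_(i | cut (S i) == cut T) w i <= isolation_index d T.
Proof.
move=> T0 CT0 jT; have [x [y [u [v [[xT yT uT vT] [-> _]]]]]] :=
  isolation_index_min d T0 CT0.
have [b jE] : exists b, forall z, (z \in S j) = (z \in T) (+) b.
  by case: (cut_inj jT) => ->; [exists false | exists true] => z;
    rewrite ?inE ?addbF ?addbT.
rewrite ler_pdivlMl // !lerBrDr le_max; apply/orP; right.
rewrite le_max; apply/orP; left.
rewrite big_mkcond /= mulr_sumr !(cut_sum dec) -!big_split /=.
apply: ler_sum => i _; have := weight_ge0 dec i.
suff : ((cut (S i) == cut T) * 2 + separates (S i) u v + separates (S i) x y <=
   separates (S i) x u + separates (S i) y v)%N.
  rewrite -(ler_nat R) !natrD natrM => le_i wi.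
  by have := ler_wpM2l wi le_i; case: ifP => _ /=; lra.
rewrite !inE in uT vT.
have [iT|_] := boolP (cut (S i) == cut T).
  rewrite (cut_eqP _ _ iT u v) (cut_eqP _ _ iT x y) (cut_eqP _ _ iT x u).
  rewrite (cut_eqP _ _ iT y v) /separates xT yT.
  by rewrite (negPf uT) (negPf vT).
have [a [c ac]] := side_compatible dec i j.
move: (ac x) (ac y) (ac u) (ac v); rewrite !jE xT yT (negPf uT) (negPf vT).
rewrite /separates; move: (x \in S i) (y \in S i) (u \in S i) (v \in S i).
by move: a b c {ac jE} => [] [] [] [] [] [] [].
Qed.

(** Indices are grouped by the cut they induce. Those inducing no split contribute nothing: the side
    is trivial and has mass 0, or the weight is bounded by a nonpositive isolation index. *)
Lemma C_normE (eta : Y -> R) : M0 eta ->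
  C_norm d eta = \sum_i w i * `|\sum_(z in S i) eta z|.
Proof.
move=> eta0; rewrite /C_norm.
have norm_cut (A B : {set Y}) : cut A = cut B ->
    `|\sum_(z in A) eta z| = `|\sum_(z in B) eta z|.
  by case/cut_inj => -> //; apply: norm_sumC.
rewrite [RHS](bigID (fun i => cut (S i) \in splits d)) /= [X in _ = _ + X]big1.
  rewrite addr0 (partition_big (fun i => cut (S i)) (mem (splits d))) //=.
  apply: eq_bigr => delta /imsetP[T].
  rewrite inE => /and3P[T0 CT0 posT] ->{delta}.
  set A := side _; have AT : cut A = cut T by exact: cut_side.
  have isoA : isolation_index d A = isolation_index d T.
    by case: (cut_inj AT) => -> //; apply: isolation_indexC => a b;
      rewrite !(cut_sum dec); under eq_bigr do rewrite separatesC.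
  rewrite isoA.
  have isoT : isolation_index d T = \sum_(i | cut (S i) == cut T) w i.
    apply/eqP; rewrite eq_le isolation_index_le //=.
    have [j /eqP jT|noj] := pickP [pred i | cut (S i) == cut T].
      exact: isolation_index_ge jT.
    by rewrite big_pred0 // ltW.
  rewrite isoT mulr_suml; apply: eq_big => [i|i /eqP iT].
    case: eqP => [->|]; rewrite ?andbF ?andbT //; apply/esym/imsetP.
    by exists T => //; rewrite inE T0 CT0.
  by rewrite (norm_cut A (S i)) // AT.
move=> i iN; have [->|i0] := eqVneq (S i) set0.
  by rewrite big_set0 normr0 mulr0.
have [Ci0|Ci0] := eqVneq (~: S i) set0.
  by rewrite -norm_sumC // Ci0 big_set0 normr0 mulr0.
have le0 : isolation_index d (S i) <= 0.
  rewrite leNgt; apply: contra iN => pos; apply/imsetP.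
  by exists (S i) => //; rewrite inE i0 Ci0.
have := le_trans (isolation_index_ge i0 Ci0 (erefl _)) le0.
rewrite (bigD1 i) //= => wi.
have wi0 : w i <= 0.
  apply: le_trans wi; rewrite lerDl; apply: sumr_ge0 => j _.
  exact: weight_ge0 dec j.
have -> : w i = 0 by apply/le_anti; rewrite wi0 (weight_ge0 dec).
by rewrite mul0r.
Qed.

(** * The Arens-Eells norm as a transport cost *)

Lemma sum_delta (eta : Y -> R) (a : Y -> Y -> R) (A : {set Y}) :
  (forall z, eta z =
     \sum_(x : Y) \sum_(y : Y) a x y * ((z == x)%:R - (z == y)%:R)) ->
  \sum_(z in A) eta z =
  \sum_(x : Y) \sum_(y : Y) a x y * ((x \in A)%:R - (y \in A)%:R).
Proof.
move=> etaE; under eq_bigr do rewrite etaE.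
rewrite exchange_big /=; apply: eq_bigr => x _.
rewrite exchange_big /=; apply: eq_bigr => y _.
by rewrite -mulr_sumr sumrB !sum_eq_mem.
Qed.

(** Cut by cut, the triangle inequality bounds the net mass of a side by the total mass that [a]
    moves across. *)
Lemma transport_cost_ge (eta : Y -> R) (a : Y -> Y -> R) :
  (forall z, eta z =
     \sum_(x : Y) \sum_(y : Y) a x y * ((z == x)%:R - (z == y)%:R)) ->
  \sum_i w i * `|\sum_(z in S i) eta z| <=
  \sum_(x : Y) \sum_(y : Y) `|a x y| * d x y.
Proof.
move=> etaE.
have -> : \sum_(x : Y) \sum_(y : Y) `|a x y| * d x y =
    \sum_i w i * \sum_(x : Y) \sum_(y : Y) `|a x y| * (separates (S i) x y)%:R.
  under [RHS]eq_bigr do rewrite mulr_sumr; rewrite [RHS]exchange_big /=.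
  apply: eq_bigr => x _; under [RHS]eq_bigr do rewrite mulr_sumr.
  rewrite [RHS]exchange_big /=; apply: eq_bigr => y _.
  by rewrite (cut_sum dec) mulr_sumr; apply: eq_bigr => i _; rewrite mulrCA.
apply: ler_sum => i _; apply: ler_wpM2l; first exact: weight_ge0 dec i.
rewrite (sum_delta _ etaE).
apply: le_trans (ler_norm_sum _ _ _) _; apply: ler_sum => x _.
apply: le_trans (ler_norm_sum _ _ _) _; apply: ler_sum => y _.
rewrite normrM; apply: ler_wpM2l => //; rewrite /separates.
by case: (x \in _); case: (y \in _);
  rewrite ?subrr ?subr0 ?sub0r ?normrN ?normr0 ?normr1.
Qed.

(* The points [y] that can be reached from [x] are those outside of all the
   sides of nonnegative mass avoiding [x]; these sides being laminar, the
   reachable set has total mass at most 0. *)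
Lemma reachable_deficit (eta : Y -> R) (x : Y) : M0 eta -> 0 < eta x ->
  exists2 y, eta y < 0 &
    forall i, separates (S i) x y -> 0 < \sum_(z in side_of (S i) x) eta z.
Proof.
move=> eta0 xpos.
pose P i := \sum_(z in side_of (S i) x) eta z <= 0.
pose F := [set ~: side_of (S i) x | i in P].
have cover_ge0 : 0 <= \sum_(z in cover F) eta z.
  apply: sum_laminar_cover_ge0 => [A B|A] /imsetP[i iP ->].
    case/imsetP=> j jP ->; apply: side_ofC_laminar.
    exact: side_compatible dec i j.
  have := eta0; rewrite /M0 (bigID (mem (side_of (S i) x))) /=.
  under [X in _ + X = _]eq_bigl do rewrite -in_setC.
  by move: iP; rewrite /P unfold_in; lra.
have xF : x \notin cover F.
  apply/bigcupP => -[A /imsetP[i _ ->]]; rewrite !inE negbK /separates addbb //.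
have [y /andP[yF yneg]|noy] :=
  pickP [pred y | (y \notin cover F) && (eta y < 0)].
  exists y => // i xy; rewrite ltNge; apply: contra yF => iP.
  apply/bigcupP; exists (~: side_of (S i) x); first exact: imset_f.
  by rewrite !inE negbK.
(* Otherwise all points outside the cover have nonnegative mass, so the total is at least [eta x],
   which is positive. *)
have := eta0; rewrite /M0 (bigID (mem (cover F))) /=.
rewrite (bigD1 x (P := fun y => y \notin cover F)) //=.
have : 0 <= \sum_(y | (y \notin cover F) && (y != x)) eta y.
  apply: sumr_ge0 => y /andP[yF _]; rewrite leNgt.
  by have /= := noy y; rewrite yF /= => ->.
lra.
Qed.

(** Induction on the number of indices whose side has nonzero mass. *)
Lemma optimal_transport (eta : Y -> R) : M0 eta ->
  exists2 a : Y -> Y -> R,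
    forall z, eta z =
      \sum_(x : Y) \sum_(y : Y) a x y * ((z == x)%:R - (z == y)%:R) &
    \sum_(x : Y) \sum_(y : Y) `|a x y| * d x y <=
    \sum_i w i * `|\sum_(z in S i) eta z|.
Proof.
have [n] := ubnP #|[set i | \sum_(z in S i) eta z != 0]|.
elim: n eta => // n IHn eta ltn eta0.
have [x xpos|nopos] := pickP [pred x | 0 < eta x]; last first.
  exists (fun _ _ => 0) => [z|]; last first.
    rewrite big1 => [|x _].
      by apply: sumr_ge0 => i _; rewrite mulr_ge0 // (weight_ge0 dec).
    by rewrite big1 // => y _; rewrite normr0 mul0r.
  rewrite big1 => [|x _]; last by rewrite big1 // => y _; rewrite mul0r.
  have /= := nopos z.
  move: eta0; rewrite /M0 (bigD1 z) //=.
  have : \sum_(i | i != z) eta i <= 0.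
    by apply: sumr_le0 => t _; have /= := nopos t; rewrite leNgt => ->.
  rewrite ltNge => s0 s1 /negbFE; lra.
have [y yneg xyP] := reachable_deficit eta0 xpos.
have neq_xy : x != y by apply: contraTneq xpos => ->; rewrite -leNgt ltW.
have [i0 i0E] := singleton_side dec x.
have sep0 : separates (S i0) x y.
  by rewrite i0E /separates !inE eqxx eq_sym (negPf neq_xy).
pose m i := \sum_(z in S i) eta z.
(* Among the sides separating [x] and [y], side [i] has the least absolute mass: moving that much
   annihilates it and reverses no sign. *)
case: (@arg_minP _ _ _ i0 (fun i => separates (S i) x y) (fun i => `|m i|) sep0)
  => i sepi imin.
(* By choice of [y], the part containing [x] has positive mass, so the sign of [m j] tells whether
   [S j] is that part. *)
have mE j : separates (S j) x y ->
    (x \in S j)%:R - (y \in S j)%:R = Num.sg (m j).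
  move=> sepj; have := xyP j sepj; rewrite /m.
  have [xj|xj] := boolP (x \in S j).
    have -> : side_of (S j) x = S j.
      by apply/setP => z; rewrite inE /separates xj; case: (z \in _).
    move: sepj; rewrite /separates xj /= => /negPf -> /gtr0_sg ->.
    by rewrite subr0.
  have -> : side_of (S j) x = ~: S j.
    by apply/setP => z; rewrite !inE /separates (negPf xj); case: (z \in _).
  have yj : y \in S j by move: sepj; rewrite /separates (negPf xj).
  have := eta0; rewrite /M0 (bigID (mem (S j))) /=.
  under [X in _ + X = _]eq_bigl do rewrite -in_setC.
  move=> mm pos; have neg : \sum_(z in S j) eta z < 0 by lra.
  by rewrite ltr0_sg // yj sub0r.
have m_neq0 j : separates (S j) x y -> m j != 0.
  move=> sepj; have := mE j sepj; move: sepj; rewrite /separates.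
  case: eqVneq => // ->; rewrite sgr0.
  by case: (x \in _); case: (y \in _) => //= _ /eqP;
    rewrite ?subr0 ?sub0r ?oppr_eq0 oner_eq0.
pose eps := `|m i|.
have eps_gt0 : 0 < eps by rewrite normr_gt0 m_neq0.
pose eta' z := eta z - eps * ((z == x)%:R - (z == y)%:R).
have m'E (A : {set Y}) : \sum_(z in A) eta' z =
    \sum_(z in A) eta z - eps * ((x \in A)%:R - (y \in A)%:R).
  by rewrite sumrB -mulr_sumr sumrB !sum_eq_mem.
have m'_sep j : separates (S j) x y ->
    \sum_(z in S j) eta' z = m j - eps * Num.sg (m j).
  by move=> sepj; rewrite m'E mE.
have m'_nsep j : ~~ separates (S j) x y -> \sum_(z in S j) eta' z = m j.
  rewrite m'E /separates; case: (x \in _); case: (y \in _) => //= _;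
    by rewrite subrr mulr0 subr0.
have eta'0 : M0 eta'.
  have := m'E setT; rewrite !inE subrr mulr0 subr0.
  rewrite /M0; under eq_bigl do rewrite inE.
  by under [X in _ = X -> _]eq_bigl do rewrite inE; rewrite eta0.
case: (IHn eta') => // [|a aE acost].
  (* Zero masses occur only on sides not separating [x] and [y], which are unchanged, while [i]
     newly joins them. *)
  rewrite -ltnS (leq_trans _ ltn) // ltnS proper_card //; apply/properP; split.
    apply/subsetP => j; rewrite !inE.
    have [/m_neq0//|/m'_nsep ->//] := boolP (separates (S j) x y).
  exists i; rewrite !inE ?m_neq0 // m'_sep //.
  by rewrite /eps mulrC -numEsg subrr eqxx.
pose b s t := a s t + eps * ((s == x) && (t == y))%:R.
have pairE (g : Y -> Y -> R) :
    \sum_s \sum_t eps * ((s == x) && (t == y))%:R * g s t = eps * g x y.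
  rewrite (bigD1 x) //= (bigD1 y) //= !eqxx mulr1 big1 ?addr0; last first.
    by move=> t /negPf ->; rewrite mulr0 mul0r.
  rewrite big1 ?addr0 // => s /negPf ->; rewrite big1 // => t _.
  by rewrite mulr0 mul0r.
exists b => [z|].
  have -> : eta z = eta' z + eps * ((z == x)%:R - (z == y)%:R) by rewrite subrK.
  rewrite aE -(pairE (fun s t => (z == s)%:R - (z == t)%:R)) -big_split /=.
  apply: eq_bigr => s _; rewrite -big_split /=; apply: eq_bigr => t _.
  by rewrite mulrDl.
have d_ge0 s t : 0 <= d s t.
  rewrite (cut_sum dec); apply: sumr_ge0 => j _.
  by rewrite mulr_ge0 // (weight_ge0 dec).
apply: (@le_trans _ _ (\sum_s \sum_t `|a s t| * d s t + eps * d x y)).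
  rewrite -(pairE d) -big_split /=; apply: ler_sum => s _.
  rewrite -big_split /=; apply: ler_sum => t _; rewrite -mulrDl.
  apply: ler_wpM2r => //; apply: le_trans (ler_normD _ _) _.
  by rewrite lerD2l ger0_norm // mulr_ge0 // ltW.
apply: le_trans (lerD acost (lexx _)) _.
(* On each separating side the absolute mass has dropped by exactly [eps], which matches its term in
   [eps * d x y]. *)
rewrite (cut_sum dec) mulr_sumr -big_split /=; apply: ler_sum => j _.
rewrite mulrCA -mulrDr; apply: ler_wpM2l; first exact: weight_ge0 dec j.
have [sepj|nsepj] := boolP (separates (S j) x y); last first.
  by rewrite mulr0 addr0 m'_nsep.
have -> : \sum_(z in S j) eta' z = Num.sg (m j) * (`|m j| - eps).
  by rewrite m'_sep // mulrBr -numEsg (mulrC eps).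
rewrite normrM normr_sg m_neq0 // mul1r mulr1 ger0_norm ?subr_ge0 ?imin //.
by rewrite subrK.
Qed.

Lemma AE_normE (eta : Y -> R) : M0 eta ->
  AE_norm d eta = \sum_i w i * `|\sum_(z in S i) eta z|.
Proof.
move=> eta0; have [a aE acost] := optimal_transport eta0.
apply/le_anti/andP; split.
  apply: le_trans acost; apply: ge_inf; last by exists a.
  by exists (\sum_i w i * `|\sum_(z in S i) eta z|) => _ [b [bE ->]];
    apply: transport_cost_ge.
apply: lb_le_inf; first by eexists; exists a.
by move=> _ [b [bE ->]]; apply: transport_cost_ge.
Qed.

End CutDecomposition.

Theorem theorem7 (R : realType) (Y : finType) (d : Y -> Y -> R) :
  tree_like d ->
  forall eta : Y -> R, M0 eta -> AE_norm d eta = C_norm d eta.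
Proof.
case/tree_like_cut_decomposition=> I [S [w dec]] eta eta0.
by rewrite (AE_normE dec eta0) (C_normE dec eta0).
Qed.
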